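(* For every positive integer $r$ and integers $0\le k\le n$, \[ q^{r\binom{k+1}{2}+(1-r)k}\,[r]_q^k\,[k]_{q^r}!\,S_r[n,k]=\sum_{\ell=0}^kq^{rk(k-\ell)}\,A^r_{n,\ell}(q)\,{n-\ell\brack k-\ell}_{q^r}. \]
   Context: $[k]_q=1+\dots+q^{k-1}$, $[0]_q=0$, $[k]_q!=\prod_{i=1}^k[i]_q$, ${n\brack k}_q=\frac{[n]_q!}{[k]_q![n-k]_q!}$; the subscript $q^r$ means $q$ replaced by $q^r$. The $r$-colored $q$-Stirling numbers of the second kind: $S_r[0,k]=\delta_{0k}$ and $S_r[n,k]=S_r[n-1,k-1]+[rk+1]_qS_r[n-1,k]$ for $n\ge1$. The colored permutation group $\mathbb{Z}_r\wr\mathfrak{S}_n$ consists of words $\pi=\pi_1^{z_1}\cdots\pi_n^{z_n}$ with $\pi_1\cdots\pi_n\in\mathfrak{S}_n$ and $z_i\in\{0,\dots,r-1\}$ ($k^0$ written $k$), totally ordered by $n^{r-1}<\dots<n^1<\dots<1^{r-1}<\dots<1^1<0<1<\dots<n$. With $\pi_0^{z_0}=0$, $\mathrm{Des}_r(\pi)=\{i\in\{0,\dots,n-1\}:\pi_i^{z_i}>\pi_{i+1}^{z_{i+1}}\}$, $\mathrm{des}_r(\pi)=|\mathrm{Des}_r(\pi)|$, $\mathrm{fmaj}_r(\pi)=r\sum_{i\in\mathrm{Des}_r(\pi)}i+\sum_iz_i$, and $A^r_{n,k}(q)$ is defined by $\sum_{\pi\in\mathbb{Z}_r\wr\mathfrak{S}_n}t^{\mathrm{des}_r(\pi)}q^{\mathrm{fmaj}_r(\pi)}=\sum_{k=0}^nA^r_{n,k}(q)t^k$.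 *)

(* Defs.v *)
From HB Require Import structures.
From mathcomp Require Import all_boot all_order all_algebra all_fingroup.
Set Implicit Arguments. Unset Strict Implicit. Unset Printing Implicit Defensive.
Import GRing.Theory Num.Theory.
Local Open Scope ring_scope.

Definition qint (k : nat) : {poly int} := \sum_(i < k) 'X^i.

Definition qfact (k : nat) : {poly int} := \prod_(i < k) qint i.+1.

(* q-binomial [n choose k]_q = [n]_q! / ([k]_q! [n-k]_q!)  (k <= n);
   the divisor is monic, so %/ is exact polynomial division. *)
Definition qbinom (n k : nat) : {poly int} :=
  qfact n %/ (qfact k * qfact (n - k)).

Definition at_qpow (r : nat) (p : {poly int}) : {poly int} := p \Po 'X^r.

Fixpoint qStirling (r n k : nat) : {poly int} :=
  match n with
  | 0 => (k == 0)%:R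
  | n'.+1 => (if k is k'.+1 then qStirling r n' k' else 0)
             + qint (r * k + 1) * qStirling r n' k
  end.

(* Colored permutations of Z_r wr S_n: pairs (s, z), letter at (0-based)
   index j is (s j).+1 with color z j. *)
Definition colperm (r n : nat) := ('S_n * {ffun 'I_n -> 'I_r})%type.

(* Order-embedding of colored letters into int realizing
   n^{r-1} < ... < n^1 < ... < 1^{r-1} < ... < 1^1 < 0 < 1 < ... < n :
   k^0 |-> k,  k^z (z>0) |-> -(k*r + z). *)
Definition letter_key (r : nat) (v c : nat) : int :=
  if c == 0%N then (v%:Z) else - ((v * r + c)%N%:Z).

(* key of position p in {0,...,n} (1-based positions, position 0 is the letter 0) *)
Definition pos_key (r n : nat) (w : colperm r n) (p : nat) : int :=
  if p is p'.+1 then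
    (if insub p' is Some j then letter_key r (w.1 j).+1 (w.2 j) else 0)
  else 0.

Definition Des_r (r n : nat) (w : colperm r n) : seq nat :=
  [seq i <- iota 0 n | pos_key w i.+1 < pos_key w i].

Definition des_r (r n : nat) (w : colperm r n) : nat := size (Des_r w).

Definition fmaj_r (r n : nat) (w : colperm r n) : nat :=
  (r * sumn (Des_r w) + \sum_(j < n) nat_of_ord (w.2 j))%N.

Definition Acol (r n k : nat) : {poly int} :=
  \sum_(w : colperm r n | des_r w == k) 'X^(fmaj_r w).

(* Main.v *)
(* Both sides are reduced to the recursion satisfied by the colored Eulerian
   polynomials,
     A_{n+1,k} = [rk+1]_q A_{n,k} + q^{r(k-1)+1} [r(n+2-k)-1]_q A_{n,k-1}.
   It comes from inserting the letters (n+1)^c, which are larger (c = 0) or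
   smaller (c > 0) than all others, into the n+1 gaps of a colored permutation
   with d descents: among the r(n+1) insertions, those keeping des_r increase
   fmaj_r by 0, 1, ..., rd, once each, and those increasing des_r increase
   fmaj_r by rd+1, ..., r(n+1)-1, once each.  On the other side, the left-hand
   side T_{n,k} satisfies
     T_{n+1,k} = q^{r(k-1)+1} [rk]_q T_{n,k-1} + [rk+1]_q T_{n,k},
   and comparing the coefficients of A_{n,l} leaves an identity between two
   neighbouring Gaussian binomials. *)

Require Import Defs.
From mathcomp Require Import all_boot all_order all_algebra all_fingroup.
From mathcomp Require Import ring zify.
Import Order.TTheory GRing.Theory Num.Theory.
Local Open Scope ring_scope.

(** * The recursive side *)

(** Multiplication by the nonzero [1 - 'X] replaces geometric sums by monomials; the identities
    between q-integers below are proved after this multiplication, and the factor is then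
    cancelled. *)
Lemma qintE n : (1 - 'X) * qint n = 1 - 'X^n.
Proof.
elim: n => [|n IH]; first by rewrite /qint big_ord0 mulr0 expr0 subrr.
by rewrite /qint big_ord_recr /= mulrDr IH exprS; ring.
Qed.

Lemma subX_neq0 : (1 - 'X : {poly int}) != 0.
Proof. by rewrite -oppr_eq0 opprB polyXsubC_eq0. Qed.

Lemma at_qpowM r p p' : at_qpow r (p * p') = at_qpow r p * at_qpow r p'.
Proof. exact: rmorphM. Qed.

Lemma qint_mul r k : qint (r * k) = qint r * at_qpow r (qint k).
Proof.
apply: (mulfI subX_neq0); rewrite mulrA !qintE.
have := congr1 (at_qpow r) (qintE k).
by rewrite /at_qpow rmorphM !rmorphB !rmorph1 /= comp_Xn_poly comp_polyX -exprM.
Qed.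

Lemma qfact_monic n : qfact n \is monic.
Proof.
apply: rpred_prod => i _; rewrite monicE lead_coefE.
have -> : qint i.+1 = \poly_(j < i.+1) 1.
  by rewrite poly_def; apply: eq_bigr => j _; rewrite scale1r.
by rewrite size_poly_eq ?oner_eq0 // coef_poly ltnSn.
Qed.

(** Gaussian binomials by the q-Pascal rule: no division, and the value 0 for [n < k]. *)
Fixpoint gauss (n k : nat) : {poly int} :=
  match n, k with
  | _, 0 => 1
  | 0, _.+1 => 0
  | n'.+1, k'.+1 => gauss n' k' + 'X^k * gauss n' k
  end.

Lemma gauss0 n : gauss n 0 = 1. Proof. by case: n. Qed.

Lemma gauss_small n k : (n < k)%N -> gauss n k = 0.
Proof.
elim: n k => [|n IH] [|k] //= nk.
by rewrite !IH ?mulr0 ?addr0 // ltnW.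
Qed.

(** In the inductive step, the hypothesis at [k] on the left and at [k - 1] on the right makes both
    sides multiples of [gauss n k]. *)
Lemma gauss_absorb n k :
  (1 - 'X^(k.+1)) * gauss n k.+1 = (1 - 'X^(n - k)) * gauss n k.
Proof.
elim: n k => [|n IH] k; first by rewrite mulr0 sub0n expr0 subrr mul0r.
have [nk|kn] := ltnP n k.
  (* By definition [n < k] is [n.+1 - k == 0], so [eqP nk] annihilates the exponent. *)
  by rewrite gauss_small // (eqP nk) expr0 subrr mulr0 mul0r.
rewrite /= mulrDr mulrCA IH; case: k kn => [|k] kn.
  by rewrite gauss0 !subn0 expr1 [in RHS]exprS; ring.
rewrite subSS [in RHS]/= [in RHS]mulrDr -[X in _ = X + _]IH.
have -> : 'X^(n - k) = 'X * 'X^(n - k.+1) :> {poly int}.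
  by rewrite -exprS; congr ('X^_); lia.
by rewrite !exprS; ring.
Qed.

Lemma qfact_gauss n k : (k <= n)%N ->
  qfact n = gauss n k * (qfact k * qfact (n - k)).
Proof.
elim: k => [|k IH] kn.
  by rewrite gauss0 subn0 /qfact big_ord0 !mul1r.
have absorb : qint k.+1 * gauss n k.+1 = qint (n - k) * gauss n k.
  by apply: (mulfI subX_neq0); rewrite !mulrA !qintE gauss_absorb.
rewrite IH ?(ltnW kn) // (_ : (n - k = (n - k.+1).+1)%N); last lia.
rewrite /qfact !big_ord_recr /= -/(qfact _) -/(qfact (n - k.+1)).
move: absorb; rewrite (_ : (n - k = (n - k.+1).+1)%N); last lia.
move=> absorb; rewrite [RHS](_ : _ = qint k.+1 * gauss n k.+1 *
  (qfact k * qfact (n - k.+1))); last by ring.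
by rewrite absorb; ring.
Qed.

Lemma qbinomE n k : (k <= n)%N -> qbinom n k = gauss n k.
Proof.
move=> kn; rewrite /qbinom (qfact_gauss n k) //.
by rewrite Pdiv.IdomainMonic.mulpK // rpredM ?qfact_monic.
Qed.

(** * Colored Eulerian recursion against the Stirling recursion *)

Fixpoint colEulerian (r n k : nat) : {poly int} :=
  match n with
  | 0 => (k == 0)%:R
  | n'.+1 => qint (r * k + 1) * colEulerian r n' k +
      if k is k'.+1 then
        'X^(r * k' + 1) * qint (r * (n'.+1 - k') - 1) * colEulerian r n' k'
      else 0
  end.

Lemma colEulerian_small r n k : (n < k)%N -> colEulerian r n k = 0.
Proof. by elim: n k => [|n IH] [|k] //= nk; rewrite !IH ?mulr0 ?addr0 // ltnW. Qed.

(* With [l = k - j] and [n = m + l], both sides are the coefficient of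
   [colEulerian r n l] when index [n.+1, k.+1] is reduced to [n]. *)
Lemma insertion_coef_identity r k j m : (0 < r)%N -> (j <= k)%N ->
  'X^(r * k.+1 * j.+1) * qint (r * (k - j) + 1) * at_qpow r (gauss m.+1 j.+1)
  + 'X^(r * k.+1 * j) * ('X^(r * (k - j) + 1) * qint (r * m.+1 - 1))
    * at_qpow r (gauss m j)
  = 'X^(r * k + 1) * qint (r * k.+1) * ('X^(r * k * j) * at_qpow r (gauss m j))
  + qint (r * k.+1 + 1) * ('X^(r * k.+1 * j.+1) * at_qpow r (gauss m j.+1)).
Proof.
move=> r0 jk; have [mj|jm] := ltnP m j.
  rewrite !(gauss_small m) ?(gauss_small m.+1) //; last exact: ltnW.
  by rewrite /at_qpow !rmorph0 !mulr0.
apply: (mulfI subX_neq0).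
have := congr1 (at_qpow r) (gauss_absorb m j).
rewrite /= {1 2}/at_qpow !rmorphM !rmorphB !rmorph1 /= !comp_Xn_poly -!exprM.
rewrite /at_qpow rmorphD rmorphM /= comp_Xn_poly -exprM.
move: (gauss m j \Po _) (gauss m j.+1 \Po _) => b0 b1 e.
transitivity ('X^(r * k.+1 * j.+1) * (1 - 'X^(r * (k - j) + 1)) *
      (b0 + 'X^(r * j.+1) * b1)
  + 'X^(r * k.+1 * j + (r * (k - j) + 1)) * (1 - 'X^(r * m.+1 - 1)) * b0).
  by rewrite -(qintE (r * (k - j) + 1)) -(qintE (r * m.+1 - 1)) !exprD; ring.
transitivity ('X^(r * k + 1 + r * k * j) * (1 - 'X^(r * k.+1)) * b0
   + (1 - 'X^(r * k.+1 + 1)) * 'X^(r * k.+1 * j.+1) * b1); last first.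
  by rewrite -(qintE (r * k.+1)) -(qintE (r * k.+1 + 1)) !exprD; ring.
(* Each power is factored into ['X] and powers with exponents [r * k.+1 * j], [r * l], [r * (m - j)]
   and [r * j.+1], which can then be treated as independent variables. *)
have [l kl] : exists l, k = (l + j)%N by exists (k - j)%N; rewrite subnK.
have -> : 'X^(r * k.+1 * j.+1) = 'X^(r * k.+1 * j) * 'X^(r * k.+1) :> {poly int}.
  by rewrite -exprD mulnS addnC.
have -> : 'X^(r * k + 1 + r * k * j) = 'X^(r * k.+1 * j) * 'X^(r * l) * 'X
    :> {poly int}.
  by rewrite -exprD -exprSr; congr ('X^_); rewrite kl; nia.
have -> : 'X^(r * k.+1 * j + (r * (k - j) + 1)) * (1 - 'X^(r * m.+1 - 1)) =
    'X^(r * k.+1 * j) * 'X^(r * l) * ('X - 'X^(r * (m - j)) * 'X^(r * j.+1))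
    :> {poly int}.
  rewrite -(exprD _ (r * (m - j)) (r * j.+1)) -mulnDr
    (_ : (m - j + j.+1 = m.+1)%N); last lia.
  rewrite {2}(_ : (r * m.+1 = r * m.+1 - 1 + 1)%N); last nia.
  by rewrite kl addnK !exprD expr1; ring.
have -> : 'X^(r * k.+1) = 'X^(r * l) * 'X^(r * j.+1) :> {poly int}.
  by rewrite -exprD; congr ('X^_); rewrite kl; nia.
rewrite !addn1 !exprSr kl addnK.
have -> : 'X^(r * (l + j).+1) = 'X^(r * l) * 'X^(r * j.+1) :> {poly int}.
  by rewrite -exprD; congr ('X^_); nia.
move: e; move: 'X^(r * j.+1) 'X^(r * l) 'X^(r * (m - j)) => y x z e.
move: ('X^_) => c.
apply/eqP; rewrite -subr_eq0; apply/eqP.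
(* The two sides differ by [c * x * y] times the absorption relation [e]. *)
rewrite -(mulr0 (c * x * y)) -(subrr ((1 - z) * b0)) -{2}e; ring.
Qed.

(** The step to [n.+1], [k.+1] calls the hypothesis at [k] and at [k.+1]; the latter may exceed [n],
    where both sides vanish. *)
Lemma stirling_colEulerian r n k : (0 < r)%N ->
  'X^(r * 'C(k.+1, 2) + k - r * k) * qint r ^+ k * at_qpow r (qfact k)
    * qStirling r n k
  = \sum_(l < k.+1) 'X^(r * k * (k - l)) * colEulerian r n l
      * at_qpow r (gauss (n - l) (k - l)).
Proof.
move=> r0; elim: n k => [|n IH] k.
  case: k => [|k] /=.
    rewrite big_ord_recl big_ord0 /= /qfact big_ord0 /at_qpow !rmorph1 bin_small //.
    by rewrite !muln0 !expr0 addr0 !mulr1.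
  rewrite mulr0 big1 // => -[[|l] lk] _ /=; last by rewrite mulr0 mul0r.
  by rewrite /at_qpow rmorph0 mulr0.
case: k => [|k].
  have := IH 0%N; rewrite !big_ord_recl !big_ord0 /= !gauss0 !addr0 add0r.
  by rewrite mulrCA => ->; ring.
rewrite /= mulrDr [in RHS](eq_bigr (fun l : 'I_k.+2 =>
   'X^(r * k.+1 * (k.+1 - l)) * qint (r * l + 1) *
      at_qpow r (gauss (n.+1 - l) (k.+1 - l)) * colEulerian r n l
   + 'X^(r * k.+1 * (k.+1 - l)) *
      at_qpow r (gauss (n.+1 - l) (k.+1 - l)) *
     match nat_of_ord l with 0 => 0 | k'.+1 =>
        'X^(r * k' + 1) * qint (r * (n.+1 - k') - 1) * colEulerian r n k' end));
  last first.
  by move=> l _; rewrite mulrDr mulrDl; congr (_ + _); [ring | rewrite mulrAC].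
(* The part of the recursion that raises the index has no term at [l = 0]; dropping it shifts that
   sum to [l <= k]. *)
rewrite big_split /= [X in _ = _ + X]big_ord_recl mulr0 add0r /=.
rewrite mulrCA IH.
have -> : 'X^(r * 'C(k.+2, 2) + k.+1 - r * k.+1) * qint r ^+ k.+1 *
    at_qpow r (qfact k.+1) * qStirling r n k =
    'X^(r * k + 1) * qint (r * k.+1) *
    ('X^(r * 'C(k.+1, 2) + k - r * k) * qint r ^+ k * at_qpow r (qfact k)
      * qStirling r n k).
  have -> : (r * 'C(k.+2, 2) + k.+1 - r * k.+1 =
             (r * 'C(k.+1, 2) + k - r * k) + (r * k + 1))%N.
    (* This bound makes the truncated subtractions in the exponents exact. *)
    have : (k <= 'C(k.+1, 2))%N.
      by elim: k {IH} => // k IHk; rewrite binS bin1; lia.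
    rewrite (binS k.+1) bin1; nia.
  rewrite [qfact k.+1]/qfact big_ord_recr /= -/(qfact k) at_qpowM.
  by rewrite qint_mul exprD exprS; ring.
(* The terms at [l = k.+1] agree and are split off; the other terms are compared for each
   [l <= k]. *)
rewrite IH [in LHS]addrC [\sum_(l < k.+2) _]big_ord_recr /= subnn.
rewrite [X in _ = X + _]big_ord_recr /= subnn !gauss0.
rewrite mulrDr -!addrA [in RHS]addrCA [in LHS]addrCA; congr (_ + _).
  by rewrite /at_qpow; ring.
rewrite [X in _ + X = _]mulr_sumr [X in X + _ = _]mulr_sumr -!big_split /=.
apply: eq_bigr => -[l lk] _ /=.
have [nl|ln] := ltnP n l.
  by rewrite colEulerian_small //; ring.
have := @insertion_coef_identity r k (k - l) (n - l) r0 (leq_subr _ _).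
rewrite subKn // -!subSn // /bump /= add1n !subSS => e.
transitivity (colEulerian r n l * ('X^(r * k.+1 * (k.+1 - l)) * qint (r * l + 1) *
    at_qpow r (gauss (n.+1 - l) (k.+1 - l)) +
    'X^(r * k.+1 * (k - l)) *
    ('X^(r * l + 1) * qint (r * (n.+1 - l) - 1)) *
    at_qpow r (gauss (n - l) (k - l)))); last by ring.
by rewrite e; ring.
Qed.

(** * Insertion of an extremal letter in a word *)

Section DescentSums.
Variable V : nmodType.
Implicit Types (D : nat -> bool) (H : nat -> V).

(** Read from right to left, the descents have 0, 1, 2, ... descents after them. *)
Lemma sum_descents D H n :
  \sum_(j < n | D j) H (\sum_(j.+1 <= i < n) D i)%N
  = \sum_(u < \sum_(i < n) D i) H u.
Proof.
elim: n H => [|n IH] H; first by rewrite !big_ord0.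
have e (j : 'I_n) : (\sum_(j.+1 <= i < n.+1) D i = \sum_(j.+1 <= i < n) D i + D n)%N.
  by rewrite big_nat_recr.
rewrite big_mkcond !big_ord_recr /= -big_mkcond /= big_geq //.
under eq_bigr do rewrite e.
rewrite (IH (fun u => H (u + D n)%N)).
case: (D n) => /=; last by rewrite addr0 addn0; under eq_bigr do rewrite addn0.
by rewrite addn1 big_ord_recl addrC; under eq_bigr do rewrite addn1.
Qed.

(** At a nondescent [j], the number [j] counts the descents and nondescents before it, so the
    argument of [H] is the total number of descents plus the number of nondescents before [j]. *)
Lemma sum_nondescents D H n :
  \sum_(j < n | ~~ D j) H (j + \sum_(j.+1 <= i < n) D i)%N
  = \sum_(\sum_(i < n) D i <= v < n) H v.
Proof.
elim: n H => [|n IH] H; first by rewrite !big_ord0 big_geq.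
have dn : (\sum_(i < n) D i <= n)%N.
  by rewrite -[leqRHS]card_ord -sum1_card leq_sum // => i _; case: (D i).
have e (j : 'I_n) : (\sum_(j.+1 <= i < n.+1) D i = \sum_(j.+1 <= i < n) D i + D n)%N.
  by rewrite big_nat_recr.
rewrite big_mkcond !big_ord_recr /= -big_mkcond /= (@big_geq _ _ _ n.+1) // addn0.
under eq_bigr do rewrite e addnA.
rewrite (IH (fun u => H (u + D n)%N)).
case: (D n) => /=; last first.
  by rewrite addn0 big_nat_recr //=; under eq_bigr do rewrite addn0.
by rewrite addn1 addr0 big_add1 /=; under eq_bigr do rewrite addn1.
Qed.

Lemma sum_blocks r H a b : (a <= b)%N ->
  \sum_(a <= u < b) \sum_(c < r) H (r * u + c.+1)%N
  = \sum_(r * a + 1 <= i < r * b + 1) H i.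
Proof.
move=> ab; rewrite -(subnK ab); elim: (b - a)%N => [|d IH].
  by rewrite !big_geq.
rewrite addSn big_nat_recr ?leq_addl //= IH.
rewrite [RHS](@big_cat_nat _ _ _ (r * (d + a) + 1)) /=; try nia.
congr (_ + _); rewrite -{1}[(_ + 1)%N]add0n big_addn.
rewrite (_ : (r * (d + a).+1 + 1 - (r * (d + a) + 1) = r)%N); last nia.
rewrite big_mkord; apply: eq_bigr => c _; congr H; lia.
Qed.

End DescentSums.

(** Gap [j] lies just after position [j]; since position 0 holds the initial letter 0, a word of
    length [n] has gaps 0 to [n]. *)
Definition insert (f : nat -> int) (j : nat) (M : int) (p : nat) : int :=
  if (p <= j)%N then f p else if p == j.+1 then M else f p.-1.

Definition desc (f : nat -> int) (i : nat) : bool := f i.+1 < f i.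

Lemma big_ord_split (h : nat -> nat) j n : (j < n)%N ->
  (\sum_(i < n) h i = \sum_(0 <= i < j) h i + h j + \sum_(j.+1 <= i < n) h i)%N.
Proof.
move=> jn; rewrite -(big_mkord xpredT h) (@big_cat_nat _ _ _ j) ?(ltnW jn) //=.
by rewrite (big_ltn jn) addnA.
Qed.

(** The weight [h] serves both statistics: the constant 1 counts the descents, the identity adds
    their positions. The comparison across gap [j] gives way to two comparisons with [M], and later
    ones move by one place. *)
Lemma sum_insert_lt f j M n (h : nat -> nat) : (j < n)%N ->
  (\sum_(i < n.+1) h i * desc (insert f j M) i =
   \sum_(0 <= i < j) h i * desc f i + h j * (M < f j)%R
    + h j.+1 * (f j.+1 < M)%R + \sum_(j.+1 <= i < n) h i.+1 * desc f i)%N.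
Proof.
move=> jn; rewrite -(big_mkord xpredT (fun i => h i * desc (insert f j M) i))%N.
rewrite (@big_cat_nat _ _ _ j) //=; last by lia.
rewrite (big_ltn (leqW jn)) (@big_ltn _ _ _ j.+1) // big_add1 /= !addnA.
congr (_ + _ + _ + _)%N.
- apply: eq_big_nat => i /andP[_ ij]; rewrite /desc /insert.
  by rewrite ij (ltnW ij).
- by rewrite /desc /insert ltnn eqxx leqnn.
- rewrite /desc /insert ltnn eqxx /= (_ : (j.+2 <= j)%N = false); last lia.
  by rewrite (_ : (j.+2 == j.+1) = false) //; lia.
apply: eq_big_nat => i /andP[ji _]; rewrite /desc /insert.
rewrite (_ : (i.+2 <= j)%N = false); last lia.
rewrite (_ : (i.+1 <= j)%N = false); last lia.
rewrite (_ : (i.+2 == j.+1) = false); last lia.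
by rewrite (_ : (i.+1 == j.+1) = false) //; lia.
Qed.

Lemma sum_insert_last f M n (h : nat -> nat) :
  (\sum_(i < n.+1) h i * desc (insert f n M) i =
   \sum_(i < n) h i * desc f i + h n * (M < f n)%R)%N.
Proof.
rewrite big_ord_recr /=; congr (_ + _)%N.
  by apply: eq_bigr => i _; rewrite /desc /insert ltn_ord (ltnW (ltn_ord i)).
by rewrite /desc /insert ltnn eqxx leqnn.
Qed.

(** An arbitrary [F] records the joint distribution of the two statistics; [m] stands for the color
    sum of the old word. A gap at a descent keeps the number of descents for every color, one at a
    nondescent raises it, and the last gap keeps it for color 0 only. *)
Lemma sum_insert (V : nmodType) (F : nat -> nat -> V) f (M : nat -> int) r n m :
  (0 < r)%N -> (forall p, (p <= n)%N -> f p < M 0%N) ->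
  (forall p c, (p <= n)%N -> (0 < c < r)%N -> M c < f p) ->
  let d := (\sum_(i < n) desc f i)%N in
  \sum_(j < n.+1) \sum_(c < r)
    F (\sum_(i < n.+1) desc (insert f j (M c)) i)%N
      (m + r * (\sum_(i < n.+1) i * desc (insert f j (M c)) i) + c)%N
  = \sum_(0 <= i < r * d + 1) F d (m + r * (\sum_(i < n) i * desc f i) + i)%N
  + \sum_(r * d + 1 <= i < r * n.+1)
       F d.+1 (m + r * (\sum_(i < n) i * desc f i) + i)%N.
Proof.
move=> r0 Mmax Mmin d; set s := (\sum_(i < n) i * desc f i)%N.
have one g k : (\sum_(i < k) desc g i = \sum_(i < k) 1 * desc g i)%N.
  by apply: eq_bigr => i _; rewrite mul1n.
have one_range a b :
    (\sum_(a <= i < b) desc f i = \sum_(a <= i < b) 1 * desc f i)%N.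
  by apply: eq_bigr => i _; rewrite mul1n.
have dn : (d <= n)%N.
  by rewrite -[leqRHS]card_ord -sum1_card leq_sum // => i _; case: desc.
pose G i := F d (m + r * s + i)%N; pose G' i := F d.+1 (m + r * s + i)%N.
case: r r0 @G @G' Mmin => // r _ G G' Mmin.
(* In every gap but the last, color 0 changes the statistics as a color [r]
   would; moving it to the end of the color sum, each gap contributes a block
   of [r] consecutive values. *)
transitivity (\sum_(j < n | desc f j) \sum_(c < r.+1)
     G (r.+1 * \sum_(j.+1 <= i < n) desc f i + c.+1)%N
  + \sum_(j < n | ~~ desc f j) \sum_(c < r.+1)
     G' (r.+1 * (j + \sum_(j.+1 <= i < n) desc f i) + c.+1)%N
  + (G 0%N + \sum_(c < r) G' (r.+1 * n + c.+1)%N)).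
  rewrite big_ord_recr /=; congr (_ + _).
    (* The old descent at [j], lost by the insertion, is added on the left to avoid subtraction. *)
    have key (j : 'I_n) c :
        (\sum_(i < n.+1) desc (insert f j (M c)) i + desc f j =
         d + (M c < f j)%R + (f j.+1 < M c)%R)%N /\
        (\sum_(i < n.+1) i * desc (insert f j (M c)) i + j * desc f j =
         s + j * (M c < f j)%R + j.+1 * (f j.+1 < M c)%R
           + \sum_(j.+1 <= i < n) desc f i)%N.
      have jn := ltn_ord j.
      split.
        rewrite one (sum_insert_lt _ _ _ _ (fun=> 1%N)) // /d.
        have /= -> := big_ord_split (fun i => nat_of_bool (desc f i)) _ _ jn.
        rewrite !mul1n.
        rewrite -!one_range; lia.
      rewrite (sum_insert_lt _ _ _ _ id) // /s.
      have /= -> := big_ord_split (fun i => i * desc f i)%N _ _ jn.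
      have -> : (\sum_(j.+1 <= i < n) i.+1 * desc f i =
        \sum_(j.+1 <= i < n) i * desc f i + \sum_(j.+1 <= i < n) desc f i)%N.
        by rewrite -big_split /=; apply: eq_bigr => i _; rewrite mulSn addnC.
      lia.
    have ltM0 (j : 'I_n) : ((M 0%N < f j) = false) * ((f j.+1 < M 0%N) = true).
      by rewrite Mmax // ltNge ltW ?Mmax // ltnW.
    have ltMc (j : 'I_n) (c : 'I_r) :
        ((M c.+1 < f j) = true) * ((f j.+1 < M c.+1) = false).
      have cr : (0 < c.+1 < r.+1)%N := ltn_ord c.
      by rewrite (Mmin j) ?(ltnW (ltn_ord j)) // lt_gtF ?Mmin.
    clearbody d s; rewrite [LHS](bigID (fun j : 'I_n => desc f j)) /=.
    congr (_ + _); apply: eq_bigr => j Dj.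
      rewrite big_ord_recl [in RHS]big_ord_recr addrC /=; congr (_ + _).
        apply: eq_bigr => c _; rewrite /= /bump add1n /G.
        by have := key j c.+1; rewrite !ltMc Dj => -[/= e1 e2]; congr F; nia.
      by have := key j 0%N; rewrite !ltM0 Dj /G => -[/= e1 e2]; congr F; nia.
    rewrite big_ord_recl [in RHS]big_ord_recr addrC /=; congr (_ + _).
      apply: eq_bigr => c _; rewrite /= /bump add1n /G'.
      have := key j c.+1; rewrite !ltMc (negbTE Dj) => -[/= e1 e2]; congr F; nia.
    have := key j 0%N; rewrite !ltM0 (negbTE Dj) /G' => -[/= e1 e2]; congr F; nia.
  rewrite big_ord_recl; congr (_ + _).
    rewrite /= one (sum_insert_last _ _ _ (fun=> 1%N)) (sum_insert_last _ _ _ id)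
      -one -/s ltNge (ltW (Mmax _ _)) //= !muln0 !addn0.
    by rewrite /G addn0.
  apply: eq_bigr => c _; rewrite /= /bump add1n.
  have cr : (0 < c.+1 < r.+1)%N := ltn_ord c.
  rewrite /= one (sum_insert_last _ _ _ (fun=> 1%N)) (sum_insert_last _ _ _ id).
  rewrite -one -/s -/d (Mmin n) //= !muln1 addn1 /G'.
  by congr F; clearbody d s; nia.
(* Descents supply the blocks [u < d] and nondescents the blocks [d <= u < n]; the last gap
   completes the ranges with the value 0 below and [r] values above. *)
rewrite (sum_descents _ _ (fun u => \sum_(c < r.+1) G (r.+1 * u + c.+1)%N)).
rewrite (sum_nondescents _ _ (fun u => \sum_(c < r.+1) G' (r.+1 * u + c.+1)%N)).
rewrite -/d -(big_mkord xpredT (fun u => \sum_(c < r.+1) G (r.+1 * u + c.+1)%N)).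
rewrite !sum_blocks // muln0 add0n.
rewrite addrACA; congr (_ + _); first by rewrite addrC [RHS]big_ltn // addn1.
rewrite [RHS](@big_cat_nat _ _ _ (r.+1 * n + 1)) /=; [| nia..].
congr (_ + _); rewrite -{1}[(r.+1 * n + 1)%N]add0n big_addn.
rewrite (_ : (r.+1 * n.+1 - (r.+1 * n + 1) = r)%N); last nia.
by rewrite big_mkord; apply: eq_bigr => c _; rewrite /G'; congr F; lia.
Qed.

(** * Colored permutations *)

Definition insert_max {r n : nat} (w : colperm r n) (j : 'I_n.+1) (c : 'I_r) :
    colperm r n.+1 :=
  (lift_perm j ord_max w.1,
   [ffun i => if unlift j i is Some i' then w.2 i' else c]).

(** The place of the largest letter reveals [j], and the rest follows; injectivity suffices because
    both sets have [(n+1)! * r^(n+1)] elements. *)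
Lemma insert_max_bij r n : bijective
  (fun x : colperm r n * ('I_n.+1 * 'I_r) => insert_max x.1 x.2.1 x.2.2).
Proof.
apply: inj_card_bij => [[[s z] [j c]] [[s' z'] [j' c']] [/= es ez]|]; last first.
  rewrite !card_prod !card_Sn !card_ffun !card_ord factS expnS.
  by apply/eq_leq; ring.
have ej : j = j'.
  have := lift_perm_id j ord_max s; rewrite es => e.
  by apply: (@perm_inj _ (lift_perm j' ord_max s')); rewrite e lift_perm_id.
subst j'; congr (_, _, _); last congr (_, _).
- apply/permP => i; apply: (@lift_inj _ ord_max).
  by rewrite -!(lift_perm_lift j) es.
- apply/ffunP => i; have /ffunP/(_ (lift j i)) := ez.
  by rewrite !ffunE liftK.
by have /ffunP/(_ j) := ez; rewrite !ffunE unlift_none.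
Qed.

Lemma pos_key_insert_max r n (w : colperm r n) j c p : (p <= n.+1)%N ->
  pos_key (insert_max w j c) p = insert (pos_key w) j (letter_key r n.+1 c) p.
Proof.
rewrite /insert; case: p => [|p] // pn.
rewrite [LHS]/=; case: insubP => [i _ /= ip|]; last by rewrite pn.
rewrite !ffunE -ip /=.
case: unliftP => [k ik|->]; last by rewrite ltnn eqxx lift_perm_id.
rewrite ik lift_perm_lift lift_max.
have [jk|kj] := leqP j k.
  have -> : lift j k = k.+1 :> nat by rewrite /= /bump jk.
  rewrite (_ : (k.+1 < j)%N = false); last lia.
  rewrite (_ : (k.+2 == j.+1) = false) /=; last by rewrite eqSS gtn_eqF.
  by rewrite insubT //= => kn; rewrite (_ : Sub _ _ = k) //; apply: val_inj.
have -> : lift j k = k :> nat by rewrite /= /bump leqNgt kj.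
rewrite kj insubT //= => kn.
by rewrite (_ : Sub _ _ = k) //; apply: val_inj.
Qed.

Lemma des_rE r n (w : colperm r n) : des_r w = (\sum_(i < n) desc (pos_key w) i)%N.
Proof.
rewrite /des_r /Des_r size_filter -sumn_count sumnE big_map.
by rewrite -(big_mkord xpredT (fun i => nat_of_bool (desc (pos_key w) i)))
  /index_iota subn0.
Qed.

Lemma sumn_DesE r n (w : colperm r n) :
  sumn (Des_r w) = (\sum_(i < n) i * desc (pos_key w) i)%N.
Proof.
rewrite /Des_r sumnE big_filter big_mkcond /=.
rewrite -(big_mkord xpredT (fun i => i * desc (pos_key w) i)%N) /index_iota subn0.
by apply: eq_bigr => i _; rewrite /desc; case: ifP; rewrite ?muln1 ?muln0.
Qed.

Lemma pos_key_lt r n (w : colperm r n) p :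
  (p <= n)%N -> pos_key w p < letter_key r n.+1 0.
Proof.
case: p => [|p] //= pn; case: insubP => [i _ _|]; last by rewrite pn.
by rewrite /letter_key /=; have := ltn_ord (w.1 i); case: ifP => _; lia.
Qed.

Lemma pos_key_gt r n (w : colperm r n) p c :
  (p <= n)%N -> (0 < c < r)%N -> letter_key r n.+1 c < pos_key w p.
Proof.
move=> pn /andP[c0 cr]; rewrite {1}/letter_key gtn_eqF //.
case: p pn => [|p] pn /=; first by lia.
case: insubP => [i _ _|]; last by rewrite pn.
(* A letter [v <= n] of color [z < r] satisfies [v * r + z < n.+1 * r]. *)
rewrite /letter_key; have := ltn_ord (w.1 i); have := ltn_ord (w.2 i).
by case: ifP => _; nia.
Qed.

Lemma sum_insert_max (V : nmodType) r n (w : colperm r n) (F : nat -> nat -> V) :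
  (0 < r)%N ->
  \sum_(j < n.+1) \sum_(c < r)
    F (des_r (insert_max w j c)) (fmaj_r (insert_max w j c))
  = \sum_(0 <= i < r * des_r w + 1) F (des_r w) (fmaj_r w + i)%N
  + \sum_(r * des_r w + 1 <= i < r * n.+1) F (des_r w).+1 (fmaj_r w + i)%N.
Proof.
move=> r0; pose m := (\sum_(i < n) w.2 i)%N.
have := @sum_insert V F (pos_key w) (letter_key r n.+1) r n m r0
  (@pos_key_lt r n w) (@pos_key_gt r n w).
rewrite /= -des_rE -sumn_DesE (addnC m) => <-.
apply: eq_bigr => j _; apply: eq_bigr => c _.
have eD (i : 'I_n.+1) : desc (pos_key (insert_max w j c)) i =
    desc (insert (pos_key w) j (letter_key r n.+1 c)) i.
  by rewrite /desc !pos_key_insert_max // ltnW.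
congr F; first by rewrite des_rE; apply: eq_bigr => i _; rewrite eD.
rewrite /fmaj_r (bigD1_ord j) //= !ffunE unlift_none.
under eq_bigr do rewrite ffunE liftK.
have -> : sumn (Des_r (insert_max w j c)) = (\sum_(i < n.+1)
    i * desc (insert (pos_key w) j (letter_key r n.+1 c)) i)%N.
  by rewrite sumn_DesE; apply: eq_bigr => i _; rewrite eD.
by rewrite addnC (addnC (nat_of_ord c)) addnAC.
Qed.

(** * The recursion for [Acol] and the conclusion *)

Lemma Acol_rec r n k : (0 < r)%N ->
  Acol r n.+1 k = qint (r * k + 1) * Acol r n k +
      if k is k'.+1 then
        'X^(r * k' + 1) * qint (r * (n.+1 - k') - 1) * Acol r n k'
      else 0.
Proof.
move=> r0; have shift a : forall m, \sum_(0 <= i < m) 'X^(a + i) = 'X^a * qint m.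
  by move=> m; rewrite big_mkord mulr_sumr; apply: eq_bigr => i _; rewrite exprD.
(* This [F] extracts the coefficient of [t^k] from the joint distribution. *)
pose F d s : {poly int} := if d == k then 'X^s else 0.
rewrite /Acol big_mkcond (reindex _ (onW_bij _ (insert_max_bij r n))) /=.
rewrite -(pair_bigA _ (fun w jc => F (des_r (insert_max w jc.1 jc.2))
   (fmaj_r (insert_max w jc.1 jc.2)))) /=.
under eq_bigr => w _.
  rewrite -(pair_bigA _ (fun j c => F (des_r (insert_max w j c))
     (fmaj_r (insert_max w j c)))) /= sum_insert_max //.
  over.
rewrite big_split /=; congr (_ + _).
  rewrite mulr_sumr [RHS]big_mkcond; apply: eq_bigr => w _.
  rewrite /F; case: eqP => [->|_]; last by rewrite big1.
  by rewrite shift mulrC.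
(* Insertions that raise the number of descents never produce 0 descents, and they produce [k.+1]
   only from words with [k]. *)
case: k @F => [|k] F.
  by rewrite big1 // => w _; rewrite big1.
rewrite mulr_sumr [RHS]big_mkcond; apply: eq_bigr => w _.
rewrite /F eqSS; case: eqP => [->|_]; last by rewrite big1.
rewrite -{1}[(r * k + 1)%N]add0n big_addn.
under eq_bigr do rewrite addnCA.
have -> : (r * n.+1 - (r * k + 1) = r * (n.+1 - k) - 1)%N by rewrite mulnBr; lia.
transitivity (\sum_(0 <= i < r * (n.+1 - k) - 1)
  'X^((fmaj_r w + (r * k + 1)) + i) : {poly int}).
  by apply: eq_bigr => i _; congr ('X^_); lia.
by rewrite shift exprD; ring.
Qed.

Lemma AcolE r n k : (0 < r)%N -> Acol r n k = colEulerian r n k.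
Proof.
move=> r0; elim: n k => [|n IH] k; last first.
  by rewrite Acol_rec //=; case: k => [|k]; rewrite !IH.
(* For [n = 0] the empty word is the only colored permutation. *)
rewrite /Acol big_mkcond (eq_bigr (fun=> (k == 0%N)%:R)) => [|w _]; last first.
  by rewrite /fmaj_r /des_r /Des_r /= big_ord0 muln0 addn0 expr0; case: k.
by rewrite sumr_const card_prod card_Sn card_ffun !card_ord expn0.
Qed.

Theorem theorem4p2 (r n k : nat) (hr : (0 < r)%N) (hkn : (k <= n)%N) :
  'X^(r * 'C(k.+1, 2) + k - r * k) * qint r ^+ k * at_qpow r (qfact k)
    * qStirling r n k
  = \sum_(l < k.+1)
      'X^(r * k * (k - l)) * Acol r n l * at_qpow r (qbinom (n - l) (k - l)).
Proof.
rewrite stirling_colEulerian //; apply: eq_bigr => l _.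
by rewrite AcolE // qbinomE // leq_sub2r.
Qed.
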